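(* Let $r\geq2$, $s\geq1$ and $m_1,\ldots,m_s\in\mathbb{N}$. Then the function $n\mapsto\prod_{i=1}^s\mu_r(n+m_i)$, i.e. $\prod_{i=1}^sA^{m_i}(\mu_r)$, is strongly asymptotically periodic.
   Context: $\mu_r(n)=1$ if $n$ is $r$-th power free and $0$ otherwise (viewed in $l^\infty(\mathbb{N})$, $\mathbb{N}=\{0,1,\ldots\}$, with any fixed value at $0$). $(Af)(n)=f(n+1)$. A mean state is a functional $E_\omega(f)=\lim_{n\to\omega}\frac1n\sum_{j=0}^{n-1}f(j)$ with $\omega$ a free ultrafilter on $\mathbb{N}$; $\|f\|_E=E(|f|^2)^{1/2}$. A function $f$ is strongly asymptotically periodic if for every mean state $E$ there is a sequence $(n_j)$ of positive integers with $\sup_{l\in\mathbb{N}}\|f-A^{ln_j}f\|_E\to0$ as $j\to\infty$. *)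

(* Defs.v *)
From HB Require Import structures.
From mathcomp Require Import all_boot all_order all_algebra.
From mathcomp Require Import complex.
From mathcomp Require Import all_classical all_reals all_analysis.
Set Implicit Arguments.
Unset Strict Implicit.
Unset Printing Implicit Defensive.
Import Order.TTheory GRing.Theory Num.Theory.
Import numFieldNormedType.Exports.
Local Open Scope classical_set_scope.
Local Open Scope ring_scope.

Definition free_ultrafilter (w : set_system nat) : Prop :=
  UltraFilter w /\ \bigcap_(A in w) A = set0.

Definition opA (R : realType) (f : nat -> R[i]) : nat -> R[i] :=
  fun n => f n.+1.

(* At n = 0 the value is 0; this is irrelevant along a free ultrafilter. *)
Definition cesaro_mean (R : realType) (f : nat -> R[i]) (n : nat) : R[i] :=
  n%:R^-1 * \sum_(j < n) f j.

(* The cast to numFieldType is what gives R[i] its usual (norm) topology.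
   For bounded f the limit exists, because w is an ultrafilter. *)
Definition mean_along (R : realType) (w : set_system nat) (f : nat -> R[i])
    : R[i] :=
  lim (cesaro_mean f @ w : set_system (R[i] : numFieldType)).

Definition is_mean_state (R : realType) (E : (nat -> R[i]) -> R[i]) : Prop :=
  exists2 w, free_ultrafilter w & E = @mean_along R w.

(* `|f n| ^+ 2 is a real element of R[i], and so is its mean; complex.Re only
   brings that value back into R. *)
Definition mean_norm (R : realType) (E : (nat -> R[i]) -> R[i])
    (f : nat -> R[i]) : R :=
  Num.sqrt (complex.Re (E (fun n => `|f n| ^+ 2))).

(* The first conjunct says that f belongs to l^oo(N). The supremum over l is
   taken in the extended reals, hence needs no boundedness proof. *)
Definition strongly_asymptotically_periodic (R : realType)
    (f : nat -> R[i]) : Prop :=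
  bounded_fun (f : nat -> (R[i] : numFieldType)) /\
  forall E : (nat -> R[i]) -> R[i], is_mean_state E ->
    exists2 n_ : nat -> nat, (forall j, 0 < n_ j)%N &
      ereal_sup [set (mean_norm E (f \- iter (l * n_ j) (@opA R) f))%:E
                | l in [set: nat]] @[j --> \oo] --> 0%E.

Definition power_free (r n : nat) : Prop :=
  forall d : nat, (1 < d)%N -> ~ (d ^ r %| n)%N.

(* c is the arbitrary value assigned at 0. *)
Definition mu (R : realType) (c : R[i]) (r n : nat) : R[i] :=
  if n == 0%N then c else if `[< power_free r n >] then 1 else 0.

(* Main.v *)
(** With T a multiple of (D!)^r, the r-freeness of x and of x + T can only
    differ if d^r divides one of them for some d > D, because d^r divides T
    when d <= D. At most a proportion of sum_(d > D) d^-2 <= 1/D of the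
    integers are divisible by d^r for some d > D; hence the shift by T moves
    the product of s factors by at most sqrt(2s/D) in mean norm, uniformly
    over all the multiples T of (D!)^r. *)

Require Import Defs.
From mathcomp Require Import all_boot all_order all_algebra.
From mathcomp Require Import complex.
From mathcomp Require Import all_classical all_reals all_analysis.
From mathcomp Require Import ring zify.
Import Order.TTheory GRing.Theory Num.Theory.
Import numFieldNormedType.Exports.
Set Implicit Arguments.
Unset Strict Implicit.
Unset Printing Implicit Defensive.
Local Open Scope classical_set_scope.
Local Open Scope complex_scope.
Local Open Scope ring_scope.

(** * Limits along a free ultrafilter *)

Lemma free_ultrafilter_infty (w : set_system nat) :
  free_ultrafilter w -> (\oo `<=` w).
Proof.
case=> wU w0.
(* By freeness some member of [w] misses [k]. Finite intersections of these complements put every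
   tail in [w]. *)
have wD k : w (~` [set k]).
  have [A wA nAk] : exists2 A, w A & ~ A k.
    apply: contrapT => H.
    have : (\bigcap_(A in w) A) k.
      by move=> A wA; apply: contrapT => nAk; apply: H; exists A.
    by rewrite w0.
  by apply: filterS wA => x Ax xk; apply: nAk; rewrite -xk.
move=> A [N _ NA].
suff : w [set n | (N <= n)%N] by apply: filterS.
elim: N {NA} => [|N IHN]; first by apply: filterS filterT.
apply: filterS (filterI IHN (wD N)) => n [/= Nn /eqP nN].
by rewrite ltn_neqAle eq_sym nN.
Qed.

Lemma ultra_compact_cvg (T : Type) (U : topologicalType) (w : set_system T)
    (K : set U) (u : T -> U) :
  UltraFilter w -> compact K -> (\forall x \near w, K (u x)) ->
  exists2 p, K p & u @ w --> p.
Proof.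
move=> wU Kc wK; have [p [Kp clp]] := Kc (u @ w) _ wK.
exists p => // B Bp; have [//|wB] := in_ultra_setVsetC (u @^-1` B) wU.
by have [y []] := clp (~` B) B wB Bp.
Qed.

Lemma real_complex_continuous (R : realType) :
  continuous (real_complex R : R -> (R[i] : numFieldType)).
Proof.
(* In the order of [R[i]], a positive radius has imaginary part 0. *)
move=> x; apply/cvgrPdist_lt => -[e e'] /=; rewrite ltcE /= => /andP[/eqP -> e0].
near=> y; rewrite -rmorphB /= normc_def /= expr0n addr0 sqrtr_sqr ltcR.
by near: y; exact: (nbhsx_ballx x _ e0).
Unshelve. all: by end_near. Qed.

(** Division by [n] turns the linear bound into [a + b / n], which tends to [a]. As [lim] says
    nothing about a divergent filter, convergence along [w] is proved as well, by compactness of a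
    segment containing the means. *)
Lemma Re_mean_along_le (R : realType) (w : set_system nat) (h : nat -> R)
    (a b : R) : free_ultrafilter w -> (forall n, 0 <= h n) ->
  (forall K, \sum_(n < K) h n <= a * K%:R + b) ->
  complex.Re (mean_along w (fun n => (h n)%:C)) <= a.
Proof.
move=> wfree h0 hab; have woo := free_ultrafilter_infty wfree.
have wU : UltraFilter w by case: wfree.
pose u n : R := n%:R^-1 * \sum_(j < n) h j.
have uE : cesaro_mean (fun n => (h n)%:C) = (real_complex R) \o u.
  apply/funext => n; rewrite /cesaro_mean /u /= rmorphM rmorph_sum /=.
  by rewrite fmorphV rmorph_nat.
have ule : \forall n \near w, u n <= a + b * n%:R^-1.
  apply: woo; near=> n.
  have n0 : 0 < n%:R :> R by rewrite ltr0n; near: n; exact: nbhs_infty_gt.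
  rewrite /u mulrC ler_pdivrMr// mulrDl -mulrA mulVf ?gt_eqF//.
  by rewrite mulr1.
have vcvg : (fun n : nat => a + b * n%:R^-1) @ w --> a.
  have : (fun n : nat => a + b * n%:R^-1) @ \oo --> a + b * 0.
    apply: cvgD; first exact: cvg_cst.
    by apply: cvgMr; rewrite -cvg_shiftS; exact: cvg_harmonic.
  by rewrite mulr0 addr0; apply: cvg_trans => B; exact: woo.
have [p _ up] : exists2 p, [set` `[0, a + `|b|]] p & u @ w --> p.
  apply: ultra_compact_cvg; first exact: segment_compact.
  apply: woo; near=> n.
  have n0 : 0 < n%:R :> R by rewrite ltr0n; near: n; exact: nbhs_infty_gt.
  rewrite /= in_itv /= mulr_ge0 ?sumr_ge0 ?invr_ge0 ?ler0n//=.
  rewrite /u mulrC ler_pdivrMr// (le_trans (hab n))// mulrDl lerD2l.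
  rewrite (le_trans (ler_norm b))// ler_peMr// ler1n.
  by near: n; exact: nbhs_infty_gt.
have lim_p : real_complex R \o u @ w --> (p%:C : (R[i] : numFieldType)).
  by apply: cvg_comp up _; exact: real_complex_continuous.
rewrite /mean_along uE (cvg_lim (@norm_hausdorff _ (R[i] : numFieldType)) lim_p) /=.
exact: ler_cvg_to up vcvg ule.
Unshelve. all: by end_near. Qed.

(** * Counting the multiples of large powers *)

Definition large_power_divisor (r D x : nat) : bool :=
  (0 < x)%N && `[< exists2 d, (D < d)%N & (d ^ r %| x)%N >].

(** Union bound: a counted [x] is a multiple of [d ^ 2] for some [d] with [D < d <= M], and [[1, M]]
    contains [M %/ d ^ 2] such multiples. *)
Lemma count_large_power_divisors (R : realType) (r D M : nat) :
  (2 <= r)%N -> (0 < D)%N ->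
  \sum_(x < M.+1) (large_power_divisor r D x)%:R
    <= D%:R^-1 * M%:R :> R.
Proof.
(* The term at 0 vanishes because [large_power_divisor] demands [0 < x]; every [d ^ r] divides 0. *)
move=> r2 D0; rewrite big_ord_recl /= add0r -(big_mkord predT
  (fun x => (large_power_divisor r D x.+1)%:R)) -(big_add1 _ _ 0 M.+1 predT
  (fun x => (large_power_divisor r D x)%:R)).
(* The telescoping needs [D <= M]. If [M <= D] nothing is counted, since [d ^ r] dividing [x] would
   give [d <= x <= M <= D < d]. *)
have [MD|DM] := leqP M D.
  rewrite big_nat_cond big1 ?mulr_ge0 ?invr_ge0 ?ler0n//.
  move=> x; rewrite andbT => /andP[x0]; rewrite ltnS => xM.
  rewrite /large_power_divisor x0; case: asboolP => //.
  move=> -[d Dd /dvdn_leq - /(_ x0) dx].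
  have : (d <= d ^ r)%N by rewrite -{1}(expn1 d) leq_pexp2l//; lia.
  lia.
apply: (@le_trans _ _ (\sum_(1 <= x < M.+1) \sum_(D.+1 <= d < M.+1)
    (d ^ 2 %| x)%N%:R)).
  rewrite big_nat_cond [leRHS]big_nat_cond; apply: ler_sum => x.
  rewrite andbT => /andP[x0]; rewrite ltnS => xM.
  rewrite /large_power_divisor x0; case: asboolP => [[d Dd dx]|_]; last first.
    exact: sumr_ge0.
  have d2x : (d ^ 2 %| x)%N by apply: dvdn_trans dx; exact: dvdn_exp2l.
  have dM : (d < M.+1)%N.
    rewrite ltnS (leq_trans _ xM)// (leq_trans _ (dvdn_leq x0 d2x))//.
    by rewrite -{1}(expn1 d) leq_pexp2l//; lia.
  rewrite (bigD1_seq d) ?iota_uniq ?mem_index_iota ?Dd//= d2x lerDl.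
  exact: sumr_ge0.
rewrite exchange_big /=.
under eq_bigr do rewrite -natr_sum -divn_count_dvd.
(* Telescoping: d^-2 <= 1/(d-1) - 1/d. *)
apply: (@le_trans _ _ (\sum_(D.+1 <= d < M.+1)
    (- (M%:R * d%:R^-1) - - (M%:R * d.-1%:R^-1)))).
  rewrite big_nat_cond [leRHS]big_nat_cond; apply: ler_sum => -[|d].
    by rewrite ltn0.
  rewrite andbT => /andP[Dd _] /=.
  have d0 : (0 < d)%N by lia.
  have d0R : 0 < d%:R :> R by rewrite ltr0n.
  rewrite opprK addrC -mulrBr.
  apply: (@le_trans _ _ (M%:R * (d.+1 ^ 2)%:R^-1)).
    rewrite ler_pdivlMr ?ltr0n ?expn_gt0// -natrM ler_nat.
    exact: leq_trunc_div.
  rewrite ler_wpM2l// -subr_ge0.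
  have -> : d%:R^-1 - d.+1%:R^-1 - (d.+1 ^ 2)%:R^-1
     = (d%:R * d.+1%:R ^+ 2)^-1 :> R.
    rewrite natrX -natr1; field; rewrite gt_eqF//= gt_eqF// ltr_wpDr//.
  by rewrite invr_ge0 mulr_ge0 ?exprn_ge0.
rewrite big_add1 /= (@telescope_sumr R D M (fun d => - (M%:R * d%:R^-1)) (ltnW DM)).
rewrite opprK addrC mulrC lerBlDr lerDl.
by rewrite mulr_ge0 ?invr_ge0.
Qed.

(** The window [[a, K + a)] lies in [[0, K + a]]; the excess [a / D] does not grow with [K], so it
    disappears in the mean. *)
Lemma count_shifted_large_power_divisors (R : realType) (r D a K : nat) :
  (2 <= r)%N -> (0 < D)%N ->
  \sum_(n < K) (large_power_divisor r D (n + a))%:R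
    <= D%:R^-1 * (K + a)%:R :> R.
Proof.
move=> r2 D0; apply: le_trans (count_large_power_divisors R (K + a) r2 D0).
rewrite -(big_mkord predT (fun n => (large_power_divisor r D (n + a))%:R)).
rewrite -(big_mkord predT (fun n => (large_power_divisor r D n)%:R)).
rewrite -{1}(addnK a K) -(@big_addn _ _ _ 0 (K + a) a predT
  (fun n => (large_power_divisor r D n)%:R)) add0n.
rewrite big_nat_recr //= (@big_cat_nat _ _ _ a 0) ?leq_addl//=.
by rewrite -addrA addrCA lerDl addr_ge0 ?sumr_ge0.
Qed.

(** * The effect of a shift on the product *)

Lemma power_free_shift (r D T x : nat) :
  (D`! ^ r %| T)%N -> (0 < x)%N ->
  ~~ large_power_divisor r D x -> ~~ large_power_divisor r D (x + T) ->
  power_free r x <-> power_free r (x + T).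
Proof.
move=> DT x0; rewrite /large_power_divisor x0 addn_gt0 x0 /=.
move=> /asboolPn nx /asboolPn nxT.
have dT d : (1 < d <= D)%N -> (d ^ r %| T)%N.
  move=> /andP[d1 dD]; apply: dvdn_trans DT; apply: dvdn_exp2r.
  by apply: dvdn_fact; rewrite dD ltnW.
split=> pf d d1; have [dD|Dd] := leqP d D.
- by rewrite dvdn_addl ?dT ?d1//; exact: pf.
- by move=> dx; apply: nxT; exists d.
- by move=> dx; apply: (pf d d1); rewrite dvdn_addl ?dT ?d1.
- by move=> dx; apply: nx; exists d.
Qed.

(** Positivity of [n] keeps each [n + m i] away from 0, where [mu] takes the arbitrary value [c]. *)
Lemma prod_muE (R : realType) (c : R[i]) (r s : nat) (m : 'I_s -> nat) (n : nat) :
  (0 < n)%N -> \prod_(i < s) mu c r (n + m i)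
    = [forall i, `[< power_free r (n + m i) >]]%:R.
Proof.
move=> n0.
have muE i : mu c r (n + m i) = `[< power_free r (n + m i) >]%:R.
  by rewrite /mu addn_eq0 gtn_eqF//=; case: ifP.
under eq_bigr do rewrite muE.
case: forallP => [all_pf|/forallP]; first by rewrite big1 // => i _; rewrite all_pf.
by move=> /forallPn[i /negPf npf]; rewrite (bigD1 i) //= npf mul0r.
Qed.

(* This is `|f n - f (n + T)| ^+ 2, as an element of R rather than R[i]. *)
Definition sqr_diff (R : realType) (f : nat -> R[i]) (T n : nat) : R :=
  complex.Re (f n - f (n + T)%N) ^+ 2 + complex.Im (f n - f (n + T)%N) ^+ 2.

Lemma sqr_diff_ge0 (R : realType) (f : nat -> R[i]) (T n : nat) :
  0 <= sqr_diff f T n.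
Proof. by rewrite addr_ge0 ?sqr_ge0. Qed.

(** Both products are 0 or 1. If they differ, some factor changes under the shift, and
    [power_free_shift] makes one of the terms for that [i] equal to 1. *)
Lemma sqr_diff_prod_mu_le (R : realType) (c : R[i]) (r s : nat)
    (m : 'I_s -> nat) (D T n : nat) :
  (D`! ^ r %| T)%N -> (0 < n)%N ->
  sqr_diff (fun n => \prod_(i < s) mu c r (n + m i)) T n <=
  \sum_(i < s) ((large_power_divisor r D (n + m i))%:R +
                (large_power_divisor r D (n + (T + m i)))%:R).
Proof.
move=> DT n0; rewrite /sqr_diff !prod_muE ?addn_gt0 ?n0//.
have le1 (x y : bool) : complex.Re (x%:R - y%:R : R[i]) ^+ 2 +
    complex.Im (x%:R - y%:R : R[i]) ^+ 2 <= (x != y)%:R.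
  by case: x y => -[] /=; rewrite ?subrr ?subr0 ?sub0r /=
    ?sqrrN ?expr1n ?expr0n ?oppr0 ?expr0n /= ?addr0.
apply: (le_trans (le1 _ _)).
have [[i lpd]|none] := pselect (exists i, large_power_divisor r D (n + m i) ||
    large_power_divisor r D (n + (T + m i))).
  rewrite (bigD1 i) //=; apply: (@le_trans _ _ 1).
    by rewrite lern1; case: (_ != _).
  apply: ler_wpDr; first by apply: sumr_ge0 => j _; exact: addr_ge0.
  by rewrite -natrD ler1n addn_gt0 !lt0b.
rewrite (_ : (_ != _) = false); first by apply: sumr_ge0 => i _; exact: addr_ge0.
apply/negbTE; rewrite negbK; apply/eqP/eq_forallb => i.
apply: asbool_equiv_eq; rewrite addnAC.
apply: (@power_free_shift _ D _ _ DT); first by rewrite addn_gt0 n0.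
  by apply/negP => lpd; apply: none; exists i; rewrite lpd.
by apply/negP => lpd; apply: none; exists i; rewrite (addnC T) addnA lpd orbT.
Qed.

Lemma sum_sqr_diff_prod_mu_le (R : realType) (c : R[i]) (r s : nat)
    (m : 'I_s -> nat) (D T : nat) :
  (2 <= r)%N -> (0 < D)%N -> (D`! ^ r %| T)%N ->
  let h := sqr_diff (fun n => \prod_(i < s) mu c r (n + m i)) T in
  exists b, forall K, \sum_(n < K) h n <= (s.*2%:R / D%:R) * K%:R + b.
Proof.
move=> r2 D0 DT h.
(* [h 0] is kept apart because it may involve [c]. The sum collects the excesses [m i] and [T + m i]
   of the two windows belonging to each [i]. *)
exists (h 0%N + D%:R^-1 * \sum_(i < s) (T + (m i).*2)%:R) => K.
pose L n : R := \sum_(i < s) ((large_power_divisor r D (n + m i))%:R +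
  (large_power_divisor r D (n + (T + m i)))%:R).
have L0 n : 0 <= L n by apply: sumr_ge0 => i _; exact: addr_ge0.
have hL : \sum_(n < K) h n <= h 0%N + \sum_(n < K) L n.
  case: K => [|K]; first by rewrite !big_ord0 addr0 sqr_diff_ge0.
  rewrite !big_ord_recl lerD2l ler_wpDl//; apply: ler_sum => n _.
  exact: sqr_diff_prod_mu_le.
apply: (le_trans hL); rewrite addrCA lerD2l exchange_big /=.
apply: (@le_trans _ _ (\sum_(i < s) D%:R^-1 * (K.*2 + (T + (m i).*2))%:R)).
  apply: ler_sum => i _; rewrite big_split /=.
  apply: le_trans (lerD (count_shifted_large_power_divisors R _ _ r2 D0)
    (count_shifted_large_power_divisors R _ _ r2 D0)) _.
  by rewrite -mulrDr -natrD; apply/ler_wpM2l; rewrite ?invr_ge0// ler_nat; lia.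
rewrite -mulr_sumr [s.*2%:R / _]mulrC -mulrA -mulrDr.
under [X in _ * X <= _]eq_bigr do rewrite natrD.
rewrite big_split /= sumr_const card_ord -[_ *+ s]mulr_natr -!natrM.
by rewrite (_ : (K.*2 * s = s.*2 * K)%N)//; lia.
Qed.

(** * Boundedness and mean norms *)

Lemma iter_opA (R : realType) (f : nat -> R[i]) (T n : nat) :
  iter T (@opA R) f n = f (n + T)%N.
Proof. by elim: T n => [|T IH] n /=; rewrite ?addn0// /opA IH addSnnS. Qed.

Lemma prod_mu_bounded (R : realType) (c : R[i]) (r s : nat) (m : 'I_s -> nat) :
  bounded_fun ((fun n => \prod_(i < s) mu c r (n + m i))
    : nat -> (R[i] : numFieldType)).
Proof.
pose f n : R[i] := \prod_(i < s) mu c r (n + m i).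
(* Only the value at 0 can involve [c]; all others are 0 or 1. *)
exists (1 + `|f 0%N|); split=> [|M fM].
  by rewrite rpredD ?normr_real ?rpred1.
move=> n _ /=; apply: le_trans (ltW fM); rewrite -/(f n).
have [->|n0] := posnP n; first by rewrite lerDr.
rewrite /f prod_muE//; case: [forall i, _]; rewrite ?normr1 ?lerDl//.
by rewrite normr0 addr_ge0.
Qed.

(** Only the coefficient of [K] in the summatory bound survives in the mean. It does not depend on
    [T], whence the uniformity over all multiples of a period. *)
Lemma mean_norm_prod_mu_le (R : realType) (c : R[i]) (r s : nat)
    (m : 'I_s -> nat) (D T : nat) (E : (nat -> R[i]) -> R[i]) :
  (2 <= r)%N -> (0 < D)%N -> (D`! ^ r %| T)%N -> is_mean_state E ->
  let f := fun n => \prod_(i < s) mu c r (n + m i) in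
  mean_norm E (f \- iter T (@opA R) f) <= Num.sqrt (s.*2%:R / D%:R).
Proof.
move=> r2 D0 DT [w wfree ->] /=; set f := (fun n : nat => \prod_(i < s) _).
apply: ler_wsqrtr.
rewrite (_ : (fun n => `|_| ^+ 2) = fun n => (sqr_diff f T n)%:C); last first.
  by apply/funext => n; rewrite /= iter_opA /sqr_diff add_Re2_Im2.
have [b hb] := sum_sqr_diff_prod_mu_le c m r2 D0 DT.
exact: Re_mean_along_le wfree (sqr_diff_ge0 f T) hb.
Qed.

Theorem theorem4p7 (R : realType) (c : R[i]) (r s : nat) (m : 'I_s -> nat)
    (hr : (2 <= r)%N) (hs : (1 <= s)%N) :
  strongly_asymptotically_periodic
    (fun n : nat => \prod_(i < s) mu c r (n + m i)%N).
Proof.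
split; first exact: prod_mu_bounded.
(* This is the choice [D = j.+1], positive for every [j]; the same periods serve all mean states. *)
move=> E Emean; exists (fun j => j.+1`! ^ r)%N => [j|].
  by rewrite expn_gt0 fact_gt0.
pose f n : R[i] := \prod_(i < s) mu c r (n + m i).
apply: (@squeeze_cvge _ _ _ _ (fun=> 0%E) _
    (fun j => (Num.sqrt (s.*2%:R / j.+1%:R))%:E)).
- apply: nearW => j; apply/andP; split.
    (* The member [l = 0] shows that the supremum is at least a square root, hence nonnegative. *)
    apply: (@le_trans _ _ (mean_norm E (f \- iter (0 * j.+1`! ^ r) (@opA R) f))%:E).
      by rewrite lee_fin sqrtr_ge0.
    by apply: ereal_sup_ubound; exists 0%N.
  apply: ge_ereal_sup => _ [l _ <-]; rewrite lee_fin.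
  by apply: mean_norm_prod_mu_le => //; exact: dvdn_mull.
- exact: cvg_cst.
- apply: cvg_EFin; first exact: nearW.
  rewrite -(sqrtr0 R) -(mulr0 s.*2%:R); apply: continuous_cvg.
    exact: sqrt_continuous.
  by apply: cvgMr; exact: cvg_harmonic.
Qed.
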